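(* Let $d$ and $e$ be graphic elements of $\mathcal{P}_{s,n}$. If $d\succeq e$ and $\{i,j\}$ is a forced pair for $e$, then $\{i,j\}$ is a forced pair for $d$.
   Context: $\mathcal{P}_{s,n}$ is the set of nonincreasing lists of $n$ nonnegative integers with sum $s$, partially ordered by dominance: $a\succeq b$ if $\sum_i a_i=\sum_i b_i$ and $\sum_{i=1}^j a_i\ge\sum_{i=1}^j b_i$ for every $j$. A list is graphic if it is the degree sequence of a (finite simple) graph. Realizations of $d=(d_1,\dots,d_n)$ are labeled graphs on vertex set $[n]$ in which vertex $\ell$ has degree $d_\ell$. A pair $\{i,j\}$ is a forced edge (resp. forced non-edge) for $d$ if $i,j$ are adjacent in every (resp. no) realization of $d$; a forced pair is a forced edge or forced non-edge. *)

(* Defs.v *)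
From mathcomp Require Import all_boot.

Set Implicit Arguments.
Unset Strict Implicit.
Unset Printing Implicit Defensive.

Record sgraph (T : finType) := SGraph {
  adj :> rel T;
  adj_sym : symmetric adj;
  adj_irrefl : irreflexive adj
}.

Definition degree (T : finType) (G : sgraph T) (v : T) : nat :=
  #|[set w | G v w]|.

Definition partitions (s n : nat) : {pred n.-tuple nat} :=
  [pred d : n.-tuple nat | sorted geq d && (\sum_(i < n) tnth d i == s)].

Arguments partitions : clear implicits.

(* Positions are numbered from 0, so the first j entries are those of index
   i < j; for j > n the partial sum is the total sum. *)
Definition dominates (n : nat) (a b : n.-tuple nat) : Prop :=
  \sum_(i < n) tnth a i = \sum_(i < n) tnth b i /\
  forall j : nat,
    \sum_(i < n | i < j) tnth b i <= \sum_(i < n | i < j) tnth a i.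

(* A degree sequence is determined only up to the order of its terms. *)
Definition graphic (n : nat) (d : n.-tuple nat) : Prop :=
  exists (T : finType) (G : sgraph T),
    perm_eq d [seq degree G v | v <- enum T].

Definition realizes (n : nat) (G : sgraph 'I_n) (d : n.-tuple nat) : Prop :=
  forall l : 'I_n, degree G l = tnth d l.

Definition forced_edge (n : nat) (d : n.-tuple nat) (i j : 'I_n) : Prop :=
  forall G : sgraph 'I_n, realizes G d -> G i j.

Definition forced_nonedge (n : nat) (d : n.-tuple nat) (i j : 'I_n) : Prop :=
  forall G : sgraph 'I_n, realizes G d -> ~~ G i j.

Definition forced_pair (n : nat) (d : n.-tuple nat) (i j : 'I_n) : Prop :=
  forced_edge d i j \/ forced_nonedge d i j.

(* Main.v *)
Require Import Defs.
From mathcomp Require Import all_boot.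
From mathcomp Require Import zify.

Set Implicit Arguments.
Unset Strict Implicit.
Unset Printing Implicit Defensive.

(** If [d] dominates [e], then [e] is reached from [d] by unit transfers from a
    vertex [p] to a vertex [q] with [d_p >= d_q + 2]. In a realization, such a
    transfer replaces an edge [pw] by [qw], and the degree gap leaves at least
    two choices for [w]. At most one of them alters the adjacency of a
    prescribed pair [{i, j}], so every realization of [d] yields a realization
    of [e] that agrees with it on [{i, j}]. *)

Section MoveEdge.
Variables (T : finType) (G : sgraph T).

Definition is_pair (a b : T) : rel T :=
  fun u v => ((u == a) && (v == b)) || ((u == b) && (v == a)).

Lemma is_pairC (a b : T) : symmetric (is_pair a b).
Proof. by move=> u v; rewrite /is_pair orbC ![(v == _) && _]andbC. Qed.

Variables p q w : T.
Hypotheses (wNp : w != p) (wNq : w != q).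

(** Exclusive or flips both pairs; it replaces [pw] by [qw] once [pw] is an edge and [qw] is not. *)
Definition move_edge_rel : rel T :=
  fun u v => G u v (+) is_pair p w u v (+) is_pair q w u v.

Lemma move_edge_sym : symmetric move_edge_rel.
Proof.
by move=> u v; rewrite /move_edge_rel adj_sym is_pairC (is_pairC q).
Qed.

Lemma move_edge_irrefl : irreflexive move_edge_rel.
Proof.
move=> u; rewrite /move_edge_rel adj_irrefl /is_pair.
by case: (eqVneq u w) => [->|_]; rewrite ?(negPf wNp) ?(negPf wNq) ?andbF.
Qed.

Definition move_edge : sgraph T := SGraph move_edge_sym move_edge_irrefl.

Hypotheses (pNq : p != q) (pw : G p w) (qw : ~~ G q w).

Lemma degree_move_edge (v : T) :
  degree move_edge v + (v == p) = degree G v + (v == q).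
Proof.
have wp : G w p by rewrite adj_sym.
have wq : G w q = false by rewrite adj_sym (negPf qw).
have nbrs u x : (x \in [set x | move_edge u x]) =
    G u x (+) is_pair p w u x (+) is_pair q w u x by rewrite inE.
have ne := (negPf pNq, negPf wNp, negPf wNq, eq_sym q p, eq_sym p w, eq_sym q w).
rewrite /degree; case: (eqVneq v p) => [->|vNp].
  rewrite (negPf pNq) addn0 addn1 [RHS](cardsD1 w) inE pw add1n.
  congr _.+1; apply: eq_card => x; rewrite nbrs !inE /is_pair !ne !eqxx /=.
  by case: (eqVneq x w) => [->|_]; rewrite ?pw /= ?addbF.
rewrite addn0; case: (eqVneq v q) => [->|vNq].
  rewrite addn1 (cardsD1 w) nbrs /is_pair (negPf qw) !ne !eqxx /= add1n.
  congr _.+1; apply: eq_card => x; rewrite in_setD1 nbrs !inE /is_pair !ne !eqxx /=.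
  by case: (eqVneq x w) => [->|_]; rewrite ?(negPf qw) /= ?addbF.
(* The vertex [w] trades the neighbour [p] for [q], so deleting [q] from the new neighbourhood and
   [p] from the old one leaves equal sets. *)
rewrite addn0; case: (eqVneq v w) => [->|vNw].
  rewrite (cardsD1 q) [RHS](cardsD1 p) nbrs inE /is_pair wp wq !ne !eqxx /=.
  congr _.+1; apply: eq_card => x.
  rewrite !in_setD1 nbrs inE /is_pair !ne !eqxx /=.
  case: (eqVneq x q) => [->|_]; first by rewrite wq andbF.
  by case: (eqVneq x p) => [->|_]; rewrite ?wp /= ?addbF.
apply: eq_card => x; rewrite nbrs inE /is_pair.
by rewrite (negPf vNp) (negPf vNq) (negPf vNw) /= !addbF.
Qed.

End MoveEdge.

(** The gap gives [p] two neighbours that are not neighbours of [q]. If [p] and [q] are adjacent,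
    [q] is one of these, but then [p] lies in the neighbourhood of [q] and not in its own, which
    yields a third. So excluding [q] still leaves a spare to avoid [x]. *)
Lemma degree_gap_neighbor (T : finType) (G : sgraph T) (p q x : T) :
  (degree G q).+1 < degree G p ->
  exists w, [/\ w != x, w != q, G p w & ~~ G q w].
Proof.
move=> gap; set A := [set w | G p w] :\: ([set w | G q w] :|: [set x; q]).
have [A0|[w]] := set_0Vmem A; last first.
  by rewrite !inE !negb_or => /andP[/and3P[? ? ?] ?]; exists w.
have sub : [set w | G p w] \subset [set w | G q w] :|: [set x; q].
  by rewrite -setD_eq0 -/A A0.
suff: degree G p <= (degree G q).+1 by rewrite leqNgt gap.
have [pq|npq] := boolP (G p q).
  have {}sub : [set w | G p w] \subset ([set w | G q w] :\ p) :|: [set x; q].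
    apply/subsetP => w pw; move/subsetP/(_ w pw): sub; move: pw.
    by rewrite !inE; case: (eqVneq w p) => [->|//]; rewrite adj_irrefl.
  have qp : p \in [set w | G q w] by rewrite inE adj_sym.
  have := subset_leq_card sub; rewrite cardsU cards2.
  rewrite /degree (cardsD1 p [set w | G q w]) qp; lia.
have {}sub : [set w | G p w] \subset x |: [set w | G q w].
  apply/subsetP => w pw; move/subsetP/(_ w pw): sub; move: pw.
  rewrite !inE; case: (eqVneq w q) => [->|_]; first by rewrite (negPf npq).
  by rewrite orbF orbC.
have := subset_leq_card sub; rewrite cardsU1 /degree; lia.
Qed.

Lemma unit_transfer (T : finType) (G : sgraph T) (i j p q : T) :
  (degree G q).+1 < degree G p ->
  exists G' : sgraph T, G' i j = G i j /\
    forall v, degree G' v + (v == p) = degree G v + (v == q).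
Proof.
move=> gap; have pNq : p != q by apply: contraTneq gap => ->; lia.
(* The flipped pairs are [pw] and [qw]. If [i] is [p] or [q], one of them can be [{i, j}] only when
   [w = j]; otherwise only when [w = i]. *)
have [w [wx wq pw qw]] :=
  @degree_gap_neighbor T G p q (if i \in [set p; q] then j else i) gap.
have wp : w != p by apply: contraTneq pw => ->; rewrite adj_irrefl.
exists (@move_edge T G p q w wp wq); split; last exact: degree_move_edge.
rewrite /= /move_edge_rel /is_pair; move: wx; rewrite !inE.
case: (eqVneq i p) => [->|ip] /=.
  by rewrite (negPf pNq) eq_sym (eq_sym p) (negPf wp) => /negPf -> /=; rewrite !addbF.
case: (eqVneq i q) => [->|iq] /=.
  by rewrite eq_sym (eq_sym q) (negPf wq) => /negPf -> /=; rewrite !addbF.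
by rewrite eq_sym => /negPf -> /=; rewrite !addbF.
Qed.

Lemma sum_nat_pred1 (I : finType) (P : pred I) (a : I) :
  \sum_(x | P x) (x == a) = P a.
Proof.
rewrite big_mkcond (bigD1 a) //= eqxx big1 => [|x /negPf ->]; last by case: ifP.
by rewrite addn0; case: (P a).
Qed.

(** Induction on the total surplus of [degree G] over [e]; truncated subtraction discards the
    deficits. The dominating sequence is [degree G] itself, which may stop being nonincreasing along
    the way. *)
Lemma realize_dominated (n : nat) (e : 'I_n -> nat) (i j : 'I_n)
    (G : sgraph 'I_n) :
  (forall x y : 'I_n, x <= y -> e y <= e x) ->
  \sum_(x < n) degree G x = \sum_(x < n) e x ->
  (forall k, \sum_(x < n | x < k) e x <= \sum_(x < n | x < k) degree G x) ->
  exists H : sgraph 'I_n, H i j = G i j /\ degree H =1 e.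
Proof.
move=> e_noninc.
have [m] := ubnP (\sum_(x < n) (degree G x - e x)).
elim: m G => // m IHm G lt_m eq_sum dom.
case: (pickP (fun x => degree G x < e x)) => [q0 q0P|ge_e]; last first.
  have le_e x : e x <= degree G x by rewrite leqNgt ge_e.
  have [_] := leqif_sum (fun x (_ : xpredT x) => leqif_eq (le_e x)).
  rewrite eq_sum eqxx => /esym/forallP eq_e.
  by exists G; split=> // x; apply/esym/eqP/eq_e.
have [q lt_q min_q] :=
  @arg_minnP _ q0 (fun x => degree G x < e x) (fun x => x : nat) q0P.
have ge_e (x : 'I_n) : x < q -> e x <= degree G x.
  by move=> lt_xq; rewrite leqNgt; apply: contraTN lt_xq => /min_q; rewrite -leqNgt.
(* Without a surplus before [q], the deficit at [q] would violate dominance on the prefix ending at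
   [q]. *)
have [p lt_pq lt_p] : exists2 p : 'I_n, p < q & e p < degree G p.
  case: (pickP (fun x : 'I_n => (x < q) && (e x < degree G x))) => [p /andP[]|no].
    by exists p.
  have := dom q.+1.
  rewrite (bigD1 q) //= [X in _ <= X](bigD1 q) //=.
  rewrite leqNgt -addSn leq_add //.
  apply: leq_sum => x /andP[]; rewrite ltnS leq_eqVlt -val_eqE /= => /orP[->//|lt_xq _].
  by rewrite leqNgt; have := no x; rewrite lt_xq => /= ->.
have gap : (degree G q).+1 < degree G p.
  by have := e_noninc p q (ltnW lt_pq); lia.
have [G' [<- degG']] := @unit_transfer _ G i j p q gap.
have sumG' (P : pred 'I_n) :
    \sum_(x < n | P x) degree G' x + P p = \sum_(x < n | P x) degree G x + P q.
  rewrite -(sum_nat_pred1 P p) -(sum_nat_pred1 P q) -!big_split.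
  by apply: eq_bigr => x _; apply: degG'.
apply: IHm => [||k].
(* The surplus at [p] drops by one, and [q], having been deficient, acquires none. *)
- rewrite ltnS in lt_m; apply: leq_trans lt_m.
  rewrite (bigD1 p) //= [X in _ < X](bigD1 p) //=.
  have := degG' p; rewrite eqxx -val_eqE /= (ltn_eqF lt_pq) => degp.
  rewrite -addSn leq_add //; first by lia.
  apply: leq_sum => x xp; have := degG' x; rewrite (negPf xp).
  by case: (eqVneq x q) => [->|_]; lia.
- by have := sumG' xpredT; rewrite eq_sum => /addIn.
have := sumG' (fun x => x < k); have := dom k.
have [lt_qk|le_kq] := ltnP q k.
  by rewrite (ltn_trans lt_pq lt_qk) => + /addIn ->.
(* Only prefixes with [p < k <= q] lose a unit. By minimality of [q] every term there is at least
   that of [e], strictly at [p], so a unit can be spared. *)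
have [lt_pk|_] := ltnP p k; last by rewrite !addn0 => + ->.
move=> _; rewrite addn0 addn1 -ltnS => ->.
rewrite (bigD1 p) //= [X in _ < X](bigD1 p) //= -addSn leq_add //.
apply: leq_sum => x /andP[lt_xk _]; apply: ge_e.
exact: leq_trans lt_xk le_kq.
Qed.

Theorem theorem4p1 (s n : nat) (d e : n.-tuple nat)
    (hdP : d \in partitions s n) (heP : e \in partitions s n)
    (hd : graphic d) (he : graphic e) (hde : dominates d e)
    (i j : 'I_n) (hij : i != j) (hf : forced_pair e i j) :
  forced_pair d i j.
Proof.
case: hde => eq_sum dom; case/andP: heP => e_sorted _.
have e_noninc (x y : 'I_n) : x <= y -> tnth e y <= tnth e x.
  move=> le_xy; rewrite !(tnth_nth 0).
  apply: (sorted_leq_nth (leT := geq)) => //; rewrite ?inE ?size_tuple //.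
    by move=> a b c /= ba cb; apply: leq_trans cb ba.
  exact: leqnn.
have realize_e (G : sgraph 'I_n) : realizes G d ->
    exists H : sgraph 'I_n, H i j = G i j /\ realizes H e.
  move=> Gd; apply: realize_dominated => [//||k].
    by rewrite -eq_sum; apply: eq_bigr => x _; apply: Gd.
  by apply: leq_trans (dom k) _; apply: leq_sum => x _; rewrite Gd.
by case: hf => fe; [left|right] => G /realize_e [H [<- /fe]].
Qed.
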